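(* For every decreasing function $\eta:\mathbf{N}\to(0,1)$ there is some $M=M(\eta)\in\mathbf{N}$ such that for every finite group $G$ the commuting probability $\Pr(G)$ can be written in the form $\Pr(G)=q+\varepsilon$, where $\mathcal{E}(q)\leq M$ and $0\leq\varepsilon\leq\eta(\mathcal{E}(q))$.
   Context: For a finite group $G$, the commuting probability is $\Pr(G)=\frac{1}{|G|^2}|\{(x,y)\in G^2: xy=yx\}|$. The Egyptian complexity $\mathcal{E}(q)$ of a rational number $q>0$ is the least positive integer $m$ such that $q=1/n_1+\cdots+1/n_m$ for some positive integers $n_1,\dots,n_m$ (not necessarily distinct); moreover $\mathcal{E}(0)=0$, and $\mathcal{E}(x)=\infty$ if $x$ is irrational. Here $q\geq 0$ is a real number (necessarily rational, since $\mathcal{E}(q)\le M<\infty$). $\mathbf{N}=\{0,1,2,\dots\}$. The integer $M$ depends only on $\eta$, not on $G$. *)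

(* Defs.v *)
From mathcomp Require Import all_boot all_order all_algebra all_fingroup.
From mathcomp Require Import boolp reals.

Set Implicit Arguments.
Unset Strict Implicit.
Unset Printing Implicit Defensive.

Import Order.TTheory GRing.Theory Num.Theory.
Local Open Scope ring_scope.

Definition commuting_prob (R : realType) (gT : finGroupType) (G : {group gT}) : R :=
  #|[set u in setX G G | (u.1 * u.2)%g == (u.2 * u.1)%g]|%:R / #|G|%:R ^+ 2.
Arguments commuting_prob R {gT} G.

Definition sum_of_unit_fractions (R : realType) (q : R) (m : nat) : Prop :=
  exists n : 'I_m -> nat,
    (forall i, (0 < n i)%N) /\ q = \sum_(i < m) (n i)%:R^-1.

(* [None] stands for an infinite complexity. Irrational numbers, and also
   negative ones, are not sums of unit fractions and therefore get [None]. *)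
Definition egyptian_complexity (R : realType) (q : R) : option nat :=
  if q == 0 then Some 0%N else
  if pselect (exists m, (0 < m)%N && `[< sum_of_unit_fractions q m >])
    is left ex_m then Some (ex_minn ex_m) else None.

Lemma egyptian_complexity0 (R : realType) :
  egyptian_complexity (0 : R) = Some 0%N.
Proof. by rewrite /egyptian_complexity eqxx. Qed.

Lemma egyptian_complexity_SomeP (R : realType) (q : R) (m : nat) : q != 0 ->
  egyptian_complexity q = Some m <->
  [/\ (0 < m)%N, sum_of_unit_fractions q m &
      forall k, (0 < k)%N -> sum_of_unit_fractions q k -> (m <= k)%N].
Proof.
move=> /negPf q0; rewrite /egyptian_complexity q0.
case: pselect => [ex_m|nex]; last first.
  by split=> // -[m0 qm _]; case: nex; exists m; rewrite m0; apply/asboolP.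
case: ex_minnP => k /andP[k0 /asboolP qk] kmin; split.
  move=> [<-]; split=> // l l0 ql.
  by apply: kmin; rewrite l0; apply/asboolP.
move=> [m0 qm mmin]; congr Some; apply/eqP.
rewrite eqn_leq (mmin k k0 qk) andbT; apply: kmin.
by rewrite m0; apply/asboolP.
Qed.

Lemma egyptian_complexity_irrational (R : realType) (q : R) :
  (forall r : rat, q <> ratr r) -> egyptian_complexity q = None.
Proof.
move=> q_irr; rewrite /egyptian_complexity; case: eqP => [q0|_].
  by case: (q_irr 0); rewrite rmorph0.
case: pselect => // ex_m; exfalso.
case: ex_m => m /andP[_ /asboolP[n [_ qE]]].
case: (q_irr (\sum_(i < m) (n i)%:R^-1)).
rewrite qE rmorph_sum; apply: eq_bigr => i _.
by rewrite fmorphV rmorph_nat.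
Qed.

(* Main.v *)
(** If [Pr(G)] exceeds [eta 0], elements with boundedly many conjugates have
   positive density, and a pigeonhole over scales yields a normal subgroup [H] of
   bounded index, made of elements with at most [N] conjugates, such that all
   elements outside [H] have far more than [N] conjugates. By B.H. Neumann's
   argument [H] has boundedly many commutators; let [C] be their centraliser in
   [H]. For [x] in [H], [a |-> [x, a]] is then a homomorphism from [C] onto a
   central subgroup [[x, C]] of [C], and only boundedly many subgroups occur. A
   second pigeonhole gives [V] normal in [G], contained in [[x, C]] for almost all
   [x] in [H], such that the preimage [B] of the centre of [C / V] has bounded
   index in [G]. Take [q = Pr(G / V) / |V|], the normalised number of pairs
   of elements of [G] whose commutator lies in [V]. Each [x] contributes at most as
   much to [q] as to [Pr(G)], with equality if every element of [V] is some
   [[x, y]], so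
   [Pr(G) - q] is nonnegative and small. As [B / V] is abelian, the commuting pairs
   of [G / V] meet each coset of [(B / V)^2] in nothing or in a coset of a
   subgroup, so [q] is a sum of at most [|G : B|^2] unit fractions. *)
Require Import Defs.
From mathcomp Require Import all_boot all_order all_algebra all_fingroup commutator zify lra.
From mathcomp Require Import boolp reals.

Set Implicit Arguments.
Unset Strict Implicit.
Unset Printing Implicit Defensive.

Import Order.TTheory GRing.Theory Num.Theory.
Local Open Scope group_scope.

(** * Elements with few conjugates *)

Lemma leq_card_bigcup (T I : finType) (P : {set I}) (A : I -> {set T}) :
  (#|\bigcup_(i in P) A i| <= \sum_(i in P) #|A i|)%N.
Proof.
apply: (big_ind2 (fun (B : {set T}) n => #|B| <= n)%N) => [|B m D n Bm Dn|//].
  by rewrite cards0.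
by rewrite (leq_trans (leq_card_setU B D)) ?leq_add.
Qed.

Lemma card_mulg_le (gT : finGroupType) (A B : {set gT}) : (#|(A * B)%g| <= #|A| * #|B|)%N.
Proof. by rewrite -cardsX -[A * B]/(mulg @2: (A, B)) curry_imset2X leq_imset_card. Qed.

Lemma card_class_mul (gT : finGroupType) (G : {group gT}) (x y : gT) :
  (#|((x * y) ^: G)%g| <= #|x ^: G| * #|y ^: G|)%N.
Proof.
apply: leq_trans (card_mulg_le _ _).
apply/subset_leq_card/subsetP => _ /imsetP[g Gg ->].
by rewrite conjMg mem_mulg // memJ_class.
Qed.

Lemma card_class_inv (gT : finGroupType) (G : {group gT}) (x : gT) :
  #|x^-1 ^: G| = #|x ^: G|.
Proof. by rewrite classVg card_invg. Qed.

Lemma card_cent1_class (gT : finGroupType) (G : {group gT}) (x : gT) :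
  (#|'C_G[x]| * #|x ^: G| = #|G|)%N.
Proof. by rewrite -index_cent1 indexgI LagrangeI. Qed.

Definition small_class (gT : finGroupType) (G : {group gT}) (n : nat) : {set gT} :=
  [set x in G | (#|x ^: G| <= n)%N].

Lemma small_class_mul (gT : finGroupType) (G : {group gT}) (m n k : nat) (x y : gT) :
  (m * n <= k)%N -> x \in small_class G m -> y \in small_class G n ->
  x * y \in small_class G k.
Proof.
rewrite !inE => mnk /andP[Gx xm] /andP[Gy yn]; rewrite groupM //=.
exact: leq_trans (card_class_mul G x y) (leq_trans (leq_mul xm yn) mnk).
Qed.

Lemma small_class_le (gT : finGroupType) (G : {group gT}) (m n : nat) :
  (m <= n)%N -> small_class G m \subset small_class G n.
Proof.
move=> mn; apply/subsetP => x; rewrite !inE => /andP[-> /=] xm.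
exact: leq_trans xm mn.
Qed.

(* If the small classes still grow at stage [k], a new translate of
   [small_class G N0] fits, disjointly, inside the set of stage [k.+1]. *)
Lemma small_class_stable (gT : finGroupType) (G : {group gT}) (N0 : nat) (F : nat -> nat) :
  (0 < N0)%N -> (forall n, n <= F n)%N ->
  (#|G| <= N0 * #|small_class G N0|)%N ->
  exists2 k, (k <= N0)%N &
    let n := (iter k (fun n => F (n * N0) * N0) N0 * N0)%N in
    small_class G (F n) \subset small_class G n.
Proof.
move=> N0_gt0 leF; set f := (fun n => F (n * N0) * N0)%N => G_le.
set X0 := small_class G N0 in G_le; pose m k := iter k f N0.
apply: contrapT => unstable.
(* For [k = N0] this gives [(N0 + 1) * #|X0| <= #|G|], against [#|G| <= N0 * #|X0|], as [X0]
   contains 1. *)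
suff grow k : (k <= N0.+1)%N -> (k.+1 * #|X0| <= #|small_class G (m k)|)%N.
  have := grow N0 (leqnSn _); rewrite leqNgt => /negP[].
  apply: (@leq_ltn_trans #|G|).
    by apply/subset_leq_card/subsetP => x; rewrite inE => /andP[].
  apply: leq_ltn_trans G_le _; rewrite mulSn -addn1 addnC leq_add2r.
  by apply/card_gt0P; exists 1; rewrite inE group1 class1G cards1 N0_gt0.
elim: k => [|k IHk] leK; first by rewrite mul1n.
have {}IHk := IHk (ltnW leK).
have /subsetPn[x xF xn] : ~~ (small_class G (F (m k * N0)%N)
    \subset small_class G (m k * N0)).
  by apply/negP => sub; apply: unstable; exists k.
have dis : [disjoint x *: X0 & small_class G (m k)].
  apply/pred0P => z /=; apply/negP => /andP[/lcosetP[y yX0 ->] xy].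
  case/negP: xn; rewrite -(mulgK y x); apply: small_class_mul xy _ => //.
  by move: yX0; rewrite !inE groupV card_class_inv.
rewrite mulSn; apply: leq_trans (leq_add (leqnn _) IHk) _.
rewrite -(card_lcoset X0 x) -cardsUI (disjoint_setI0 dis) cards0 addn0.
apply/subset_leq_card; rewrite subUset; apply/andP; split.
  by apply/subsetP => _ /lcosetP[y yX0 ->]; exact: small_class_mul xF yX0.
apply: small_class_le; rewrite /m iterS /f.
by rewrite (leq_trans _ (leq_trans (leF _) (leq_pmulr _ N0_gt0))) ?leq_pmulr.
Qed.

(** Class lengths are submultiplicative, so a product of two elements of stage [n] lies in stage
    [n * n], hence again in stage [n]. Normality holds because conjugate elements share their
    class. *)
Lemma small_class_group (gT : finGroupType) (G : {group gT}) (n : nat) :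
  (0 < n)%N -> small_class G (n * n)%N \subset small_class G n ->
  exists2 H : {group gT}, H <| G & H = small_class G n :> {set gT}.
Proof.
move=> n_gt0 /subsetP stable.
have gH : group_set (small_class G n).
  apply/group_setP; split; first by rewrite inE group1 class1G cards1.
  by move=> x y xn yn; apply: stable; apply: small_class_mul xn yn.
exists (Group gH) => //; apply/andP; split => /=.
  by apply/subsetP => x; rewrite inE => /andP[].
apply/normsP => g Gg; apply/setP => x.
by rewrite mem_conjg !inE groupJr ?groupV // classGidl ?groupV.
Qed.

(** * Indices, and Neumann's bound on the number of commutators *)

Lemma card_rcosets_sum (gT : finGroupType) (G B : {group gT}) (R : {set gT}) :
  B \subset G -> R \subset G ->
  #|R| = (\sum_(K in rcosets B G) #|R :&: K|)%N.
Proof.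
move=> sBG /setIidPr RG; rewrite -{1}RG -sum1_card.
under eq_bigl do rewrite inE.
rewrite (set_partition_big_cond _ (rcosets_partition sBG)) /=.
apply: eq_bigr => K _; rewrite -sum1_card.
by apply: eq_bigl => x; rewrite inE andbC.
Qed.

Lemma leq_index_setI (gT : finGroupType) (G A B : {group gT}) :
  (#|G : A :&: B| <= #|G : A| * #|G : B|)%N.
Proof.
rewrite -[#|G : A|]indexgI -[#|G : A :&: B|]indexgI setIA.
rewrite -(Lagrange_index (subsetIl G A) (subsetIl (G :&: A) B)) leq_mul //.
rewrite (indexgI (G :&: A)%G B); apply: subset_leq_card.
exact: imsetS (subsetIl G A).
Qed.

Lemma leq_index_bigcap (gT : finGroupType) (I : finType) (P : {set I})
    (K : I -> {group gT}) (G : {group gT}) (L : nat) :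
  (forall i, i \in P -> (#|G : K i| <= L)%N) ->
  (#|G : \bigcap_(i in P) K i| <= L ^ #|P|)%N.
Proof.
rewrite cardE -[\bigcap_(i in P) K i]big_enum => PL.
have {PL}: forall i, i \in enum P -> (#|G : K i| <= L)%N.
  by move=> i; rewrite mem_enum => /PL.
elim: (enum P) => [|i s IHs] sL /=; first by rewrite big_nil -indexgI setIT indexgg.
have [B defB] : exists B : {group gT}, \bigcap_(j <- s) K j = B :> {set gT}.
  elim: (s) => [|j r [B defB]]; first by exists [set: gT]%G; rewrite big_nil.
  by exists (K j :&: B)%G; rewrite big_cons defB.
move: IHs; rewrite big_cons /= defB => IHs.
rewrite expnS; apply: leq_trans (leq_index_setI _ _ _) (leq_mul _ (IHs _)).
  by rewrite sL ?mem_head.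
by move=> j js; rewrite sL // inE js orbT.
Qed.

Lemma leq_index_cent (gT : finGroupType) (A : {set gT}) (G : {group gT}) (L : nat) :
  (forall a, a \in A -> (#|a ^: G| <= L)%N) ->
  (#|G : 'C(A)| <= L ^ #|A|)%N.
Proof.
move=> AL; apply: (leq_index_bigcap (K := fun x => 'C[x]%G)) => a /AL.
by rewrite -index_cent1 indexgI.
Qed.

(* Neumann's argument: if [x] has a largest class in [H], then for [u] in a
   subgroup [U] of bounded index the class of [u * x] is [u *: (x ^: H)], which
   forces all [u^-1 * u ^ g] into the product of [x ^: H] with its inverse. *)
Lemma card_commg_set (gT : finGroupType) (H : {group gT}) (N : nat) :
  (forall x, x \in H -> (#|x ^: H| <= N)%N) ->
  (#|commg_set H H| <= N ^ (N + 3))%N.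
Proof.
move=> HN; have N_gt0 : (0 < N)%N.
  by have := HN 1 (group1 H); rewrite class1G cards1.
have [x Hx xmax] : exists2 x, x \in H &
    forall y, y \in H -> (#|y ^: H| <= #|x ^: H|)%N.
  by case: (@arg_maxnP _ 1 [pred y in H] (fun y => #|y ^: H|) (group1 H)) => x; exists x.
(* A chosen conjugator taking [x] to [z]; the default 1 is never met for [z] in the class of [x]. *)
pose y (z : gT) : gT := odflt 1 [pick h in H | x ^ h == z].
have yP z : z \in x ^: H -> y z \in H /\ x ^ y z = z.
  case/imsetP=> h Hh ->; rewrite /y; case: pickP => [k /andP[Hk /eqP] //|/(_ h)].
  by rewrite Hh eqxx.
pose Y := [set y z | z in x ^: H]; pose U := 'C_H(Y)%G.
have indexU : (#|H : U| <= N ^ N)%N.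
  rewrite indexgI; apply: leq_trans (leq_index_cent (L := N) _) _.
    by move=> _ /imsetP[z /yP[Hz _] ->]; exact: HN.
  by rewrite leq_pexp2l // (leq_trans (leq_imset_card _ _)) // HN.
(* As [u] commutes with each chosen conjugator, [u * z = (u * x) ^ y z]. This gives one inclusion,
   and maximality of the class of [x] makes it an equality. *)
have classU u : u \in U -> (u * x) ^: H = u *: (x ^: H).
  case/setIP=> Hu /centP cu; apply/esym/eqP.
  rewrite eqEcard card_lcoset xmax ?groupM // andbT.
  apply/subsetP => _ /lcosetP[z xz ->]; have [Hy xy] := yP z xz.
  rewrite -{1}xy; apply/imsetP; exists (y z) => //; rewrite conjMg.
  by rewrite [u ^ _]conjgE (cu _ (imset_f y xz)) mulKg.
pose Q := \bigcup_(K in rcosets U H) ((repr K)^-1 *: (repr K ^: H)).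
have sub : commg_set H H \subset (x ^: H * (x ^: H)^-1) * Q.
  apply/subsetP => _ /imset2P[h g Hh Hg ->].
  have UHh : U :* h \in rcosets U H by apply/rcosetsP; exists h.
  set r := repr (U :* h).
  have /rcosetP[v Uv rE] : r \in U :* h by apply: mem_repr (rcoset_refl U h).
  have Hv : v \in H by case/setIP: Uv.
  have Hr : r \in H by rewrite rE groupM.
  have [u Uu hE] : exists2 u, u \in U & h = u * r.
    by exists v^-1; rewrite ?groupV // rE mulKg.
  have : (u * x) ^ g \in u *: (x ^: H) by rewrite -classU // memJ_class.
  case/lcosetP=> z xz; rewrite conjMg => uxg.
  have ug : u^-1 * u ^ g = z * (x ^ g)^-1.
    by rewrite -(mulgK (x ^ g) (u ^ g)) uxg !mulgA mulVg mul1g.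
  (* The first factor lies in the product of [x ^: H] with its inverse; the second depends only on
     [g] and the coset representative [r]. *)
  have -> : [~ h, g] = (z * (x ^ g)^-1) ^ r * (r^-1 * r ^ g).
    by rewrite -ug commgEl hE invMg conjMg !conjgE !mulgA !mulgK.
  apply: mem_mulg; last first.
    apply/bigcupP; exists (U :* h) => //.
    by apply/lcosetP; exists (r ^ g) => //; apply: memJ_class.
  rewrite conjMg conjVg mem_mulg //; last rewrite inE invgK.
    by case/imsetP: xz => k Hk ->; rewrite -conjgM memJ_class ?groupM.
  by rewrite -conjgM memJ_class ?groupM.
apply: leq_trans (subset_leq_card sub) _.
apply: leq_trans (card_mulg_le _ _) _.
have -> : (N ^ (N + 3) = N * N * (N ^ N * N))%N.
  by rewrite addnC expnD !expnS expn0 muln1 -!mulnA [(N * N ^ N)%N]mulnC.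
apply: leq_mul.
  apply: leq_trans (card_mulg_le _ _) _.
  by rewrite card_invg leq_mul ?HN.
apply: leq_trans (leq_card_bigcup _ _) _.
apply: (@leq_trans (\sum_(K in rcosets U H) N)); last first.
  by rewrite sum_nat_const leq_mul2r indexU orbT.
apply: leq_sum => _ /rcosetsP[h Hh ->]; rewrite card_lcoset HN //.
have /rcosetP[v /setIP[Hv _] ->] := mem_repr_rcoset U h; exact: groupM.
Qed.

(** * The subgroups [[x, C]] and their generic part [V] *)

Lemma chain_stabilises (T : finType) (P : nat -> {set T}) (J : nat) :
  (forall j, P j \subset P j.+1) -> (forall j, #|P j| <= J)%N ->
  exists2 j, (j <= J)%N & P j.+1 = P j.
Proof.
move=> Pinc PJ; apply: contrapT => Pne.
suff grow j : (j <= J.+1)%N -> (j <= #|P j|)%N.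
  by have := leq_trans (grow _ (leqnn _)) (PJ _); rewrite ltnn.
elim: j => // j IHj ltj; apply: leq_ltn_trans (IHj (ltnW ltj)) _.
apply: proper_card; rewrite properEneq Pinc andbT.
by apply/eqP => eqP; apply: Pne; exists j.
Qed.

(** The plain set of commutators, not the subgroup they generate: containing [V] then means that
    each element of [V] is a single commutator with [x]. *)
Definition commset (gT : finGroupType) (x : gT) (C : {set gT}) : {set gT} :=
  [set [~ x, a] | a in C].

(** For [W] normal in the group [C], this is the preimage of the centre of [C / W]. *)
Definition center_mod (gT : finGroupType) (C W : {set gT}) : {set gT} :=
  [set a in C | commset a C \subset W].

(** Removes the conjugation from [[~ x, b * a] = [~ x, a] * [~ x, b] ^ a]. It will hold for [C] the
    centraliser in [H] of all commutators of [H]. *)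
Definition centralised_commg (gT : finGroupType) (H C : {set gT}) : Prop :=
  forall x a b, x \in H -> a \in C -> b \in C -> [~ x, a] ^ b = [~ x, a].

Lemma commset_conj (gT : finGroupType) (C : {group gT}) (x g : gT) :
  g \in 'N(C) -> commset x C :^ g = commset (x ^ g) C.
Proof.
move=> nCg; apply/setP => z; rewrite mem_conjg; apply/imsetP/imsetP => -[a Ca].
  by move=> zE; exists (a ^ g); rewrite ?memJ_norm // -conjRg -zE conjgKV.
by move=> ->; exists (a ^ g^-1); rewrite ?memJ_norm ?groupV // conjRg conjgK.
Qed.

Lemma commset_group (gT : finGroupType) (H C : {group gT}) (x : gT) :
  centralised_commg H C -> x \in H -> group_set (commset x C).
Proof.
move=> cHC Hx; apply/group_setP; split.
  by apply/imsetP; exists 1; rewrite ?commg1.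
move=> _ _ /imsetP[a Ca ->] /imsetP[b Cb ->].
by apply/imsetP; exists (b * a); rewrite ?groupM // commgMJ cHC.
Qed.

Lemma center_mod_group (gT : finGroupType) (H C W : {group gT}) :
  C \subset H -> centralised_commg H C -> group_set (center_mod C W).
Proof.
move=> /subsetP sCH cHC; apply/group_setP; split.
  rewrite inE group1; apply/subsetP => _ /imsetP[c _ ->].
  by rewrite comm1g.
move=> a b; rewrite !inE => /andP[Ca /subsetP aW] /andP[Cb /subsetP bW].
rewrite groupM //; apply/subsetP => _ /imsetP[c Cc ->].
rewrite commMgJ (cHC _ _ _ (sCH _ Ca) Cc Cb).
by apply: groupM; [apply: aW | apply: bW]; apply: imset_f.
Qed.

(** If [x] and [x * c], with [c] in [C], both belong to the fibre, then [[~ x * c, b] = [~ x, b] *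
    [~ c, b]] puts [[~ c, b]] in [W]. So each coset of [C] meets the fibre within one translate of
    [center_mod C W]. *)
Lemma card_commset_fiber (gT : finGroupType) (H C W : {group gT}) :
  C <| H -> centralised_commg H C ->
  (#|[set x in H | commset x C == W]| <= #|H : C| * #|center_mod C W|)%N.
Proof.
move=> /andP[sCH nCH] cHC; set E := [set x in H | _].
rewrite (card_rcosets_sum (R := E) sCH); last by apply/subsetP => x /setIdP[].
rewrite -sum_nat_const; apply: leq_sum => _ /rcosetsP[h Hh ->].
have [->|[x]] := set_0Vmem (E :&: C :* h); first by rewrite cards0.
rewrite !inE => /andP[/andP[Hx /eqP xW] Cxh].
rewrite -(card_lcoset (center_mod C W) x); apply/subset_leq_card/subsetP => z.
rewrite -(rcoset_eqP Cxh) (norm_rlcoset (subsetP nCH x Hx)).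
move=> /setIP[/setIdP[Hz /eqP zW] /lcosetP[c Cc zE]].
rewrite zE mem_lcoset mulKg inE Cc; apply/subsetP => _ /imsetP[b Cb ->].
have : [~ z, b] \in W by rewrite -zW imset_f.
rewrite zE commMgJ cHC // groupMl //.
by rewrite -xW imset_f.
Qed.

Lemma norms_commg_set (gT : finGroupType) (G H : {group gT}) :
  G \subset 'N(H) -> G \subset 'N(commg_set H H).
Proof.
move=> /subsetP nHG; apply/subsetP => g Gg; rewrite inE.
apply/subsetP => _ /imsetP[_ /imset2P[x y Hx Hy ->] ->].
by rewrite conjRg; apply: imset2_f; rewrite memJ_norm ?nHG.
Qed.

(* Among the subgroups [[x, C]], keep those that occur for a proportion at least
   [1/L] of the [x] in [H], and let [V] be their intersection. The pigeonhole
   principle provides an [L] for which all others have proportion below [1/F L]. *)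
Lemma generic_commset (N0 N : nat) (F : nat -> nat) (gT : finGroupType) (G H : {group gT}) :
  (forall n, n <= F n)%N -> H <| G -> (#|G : H| <= N0)%N ->
  (forall x, x \in H -> (#|x ^: H| <= N)%N) ->
  let t := (N ^ (N + 3))%N in let J := (2 ^ t)%N in
  exists2 j, (j <= J)%N & let L := iter j F 1%N in
  exists V B : {group gT}, [/\ G \subset 'N(V), B <| G, [~: B, B] \subset V,
    (#|G : B| <= N0 * N ^ t * L ^ J)%N &
    (F L * #|[set x in H | ~~ (V \subset commset x G)]| <= J * #|H|)%N].
Proof.
move=> leF nsHG indexH HN t J; have [sHG nHG] := andP nsHG.
set T := commg_set H H; have cardT : (#|T| <= t)%N := card_commg_set HN.
have nTG : G \subset 'N(T) := norms_commg_set nHG.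
have N_gt0 : (0 < N)%N by have := HN 1 (group1 H); rewrite class1G cards1.
pose C := 'C_H(T)%G.
have nsCG : C <| G.
  by rewrite /normal (subset_trans (subsetIl _ _)) //= normsI // norms_cent.
have sCH : C \subset H := subsetIl _ _.
have nsCH : C <| H := normalS sCH sHG nsCG.
have nCG g : g \in G -> g \in 'N(C) := subsetP (normal_norm nsCG) g.
have CT x a : x \in H -> a \in C -> [~ x, a] \in T.
  by move=> Hx /(subsetP sCH) Ha; apply: imset2_f.
have cHC : centralised_commg H C.
  move=> x a b Hx Ca /setIP[_ /centP cb].
  by rewrite conjgE -(cb _ (CT x a Hx Ca)) mulKg.
have indexC : (#|H : C| <= N ^ t)%N.
  rewrite indexgI; apply: leq_trans (leq_index_cent (L := N) _) _.
    by move=> _ /imset2P[x y Hx Hy ->]; rewrite HN ?groupR.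
  by rewrite leq_pexp2l.
pose E W := [set x in H | commset x C == W].
pose freq L := [set W in powerset T | (#|H| <= L * #|E W|)%N].
have card_freq L : (#|freq L| <= J)%N.
  apply: leq_trans (_ : #|powerset T| <= _)%N.
    by apply/subset_leq_card/subsetP => W; rewrite inE => /andP[].
  by rewrite card_powerset leq_pexp2l.
have [j leJ stable] : exists2 j, (j <= J)%N & freq (iter j.+1 F 1%N) = freq (iter j F 1%N).
  apply: (@chain_stabilises _ (fun j => freq (iter j F 1%N))) => // j.
  apply/subsetP => W; rewrite !inE => /andP[-> /= le].
  by apply: leq_trans le _; rewrite leq_mul2r leF orbT.
exists j => // L; rewrite -/L /= -/L in stable.
have freqP W : W \in freq L -> exists2 x, x \in H & commset x C = W.
  rewrite inE => /andP[_ le]; have /card_gt0P[x] : (0 < #|E W|)%N.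
    by rewrite lt0n; apply: contraTneq le => ->; rewrite muln0 -ltnNge cardG_gt0.
  by rewrite inE => /andP[Hx /eqP]; exists x.
have freq_gen W : W \in freq L -> <<W>> = W.
  by case/freqP => x Hx <-; apply: gen_set_id; apply: commset_group cHC Hx.
(* Conjugation by [g] carries [E W] into [E (W :^ g)]; thus [G] permutes the frequent subgroups and
   normalises their intersection. *)
have freqJ W g : g \in G -> W \in freq L -> W :^ g \in freq L.
  move=> Gg; rewrite !inE => /andP[sWT le].
  rewrite -(normsP nTG g Gg) conjSg sWT; apply: leq_trans le _.
  rewrite leq_mul2l -(cardJg (E W) g); apply/orP; right.
  apply/subset_leq_card/subsetP => _ /imsetP[x /setIdP[Hx /eqP xW] ->].
  by rewrite inE memJ_norm ?(subsetP nHG) // Hx -commset_conj ?xW ?nCG ?eqxx.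
(* Each frequent [W] is already a subgroup; [<<W>>] only supplies the group structure. Intersecting
   with [G] keeps [V] inside [G] even if the family is empty. *)
pose V := (G :&: \bigcap_(W in freq L) <<W>>)%G.
pose B := <<center_mod C V>>%G.
have BE : B = center_mod C V :> {set gT} by apply: gen_set_id; apply: center_mod_group cHC.
have VP v : v \in V <-> v \in G /\ forall W, W \in freq L -> v \in W.
  split.
    by case/setIP=> Gv /bigcapP vW; split=> // W fW; rewrite -(freq_gen W fW) vW.
  case=> Gv vW; apply/setIP; split=> //; apply/bigcapP => W fW.
  by have := vW W fW; rewrite -{1}(freq_gen W fW).
have nVG : G \subset 'N(V).
  apply/subsetP => g Gg; rewrite inE; apply/subsetP => _ /imsetP[v /VP[Gv vW] ->].
  apply/VP; split=> [|W fW]; first by rewrite groupJ.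
  by rewrite -mem_conjgV vW // freqJ ?groupV.
exists V, B; split=> //.
- rewrite /normal BE; apply/andP; split.
    apply/subsetP => a; rewrite inE => /andP[Ca _].
    exact: (subsetP (normal_sub nsCG)).
  apply/subsetP => g Gg; rewrite inE; apply/subsetP => _ /imsetP[a /setIdP[Ca aV] ->].
  by rewrite inE memJ_norm ?nCG // Ca -commset_conj ?nCG // -(normsP nVG g Gg) conjSg.
- rewrite gen_subG; apply/subsetP => _ /imset2P[a b Ba Bb ->].
  move: Ba Bb; rewrite BE => /setIdP[_ /subsetP aV] /setIdP[Cb _].
  exact: aV (imset_f _ Cb).
- rewrite -(Lagrange_index sHG (_ : B \subset H)); last first.
    by rewrite BE; apply/subsetP => a; case/setIdP=> /(subsetP sCH).
  have sBC : B \subset C by rewrite BE; apply/subsetP => a; rewrite inE => /andP[].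
  rewrite -(Lagrange_index sCH sBC) -mulnA.
  apply: leq_mul => //; apply: leq_mul => //.
  (* An element of [C] that is central modulo every frequent [W] is central modulo [V], so
     [#|C : B|] is at most a product of at most [J] indices. *)
  pose Z := (C :&: \bigcap_(W in freq L) <<center_mod C W>>)%G.
  have sZB : Z \subset B.
    apply/subsetP => a; rewrite BE => /setIP[Ca /bigcapP aZ]; rewrite inE Ca.
    apply/subsetP => _ /imsetP[c Cc ->]; apply/VP; split.
      by rewrite groupR // (subsetP (normal_sub nsCG)).
    move=> W fW; have [x Hx xW] := freqP W fW.
    have gW := commset_group cHC Hx; rewrite xW in gW.
    have : a \in <<center_mod C W>> := aZ W fW.
    rewrite gen_set_id; last exact: (center_mod_group (Group gW) sCH cHC).
    by case/setIdP=> _ /subsetP; apply; apply: imset_f.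
  apply: leq_trans (dvdn_leq (indexg_gt0 _ _) (indexgS C sZB)) _.
  rewrite indexgI; apply: leq_trans (leq_index_bigcap (L := L) _) _; last first.
    suff L_gt0 : (0 < L)%N by rewrite leq_pexp2l.
    by rewrite /L; elim: (j) => //= i IHi; exact: leq_trans IHi (leF _).
  move=> W fW; have [x Hx xW] := freqP W fW.
  have gW := commset_group cHC Hx; rewrite xW in gW.
  have gZ := center_mod_group (Group gW) sCH cHC.
  pose K := Group gZ; suff: (#|C : K| <= L)%N by rewrite /= (gen_set_id gZ).
  have sKC : K \subset C by apply/subsetP => a; rewrite inE => /andP[].
  (* As [W] is frequent, [#|H| <= L * #|E W| <= L * #|H : C| * #|K|]; cancelling bounds the index of
     [K] in [C] by [L]. *)
  rewrite -(leq_pmul2l (cardG_gt0 K)) Lagrange // mulnC.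
  rewrite -(leq_pmul2l (indexg_gt0 H C)) mulnC Lagrange //.
  move: fW; rewrite inE => /andP[_ /leq_trans]; apply.
  rewrite mulnCA leq_mul2l; apply/orP; right.
  exact: (card_commset_fiber (Group gW) nsCH cHC).
- set bad := [set x in H | _].
  (* For a bad [x], [commset x C] is not in [freq L], hence by stability not in [freq (F L)]: its
     fibre has fewer than [#|H| / F L] elements. *)
  have sub : bad \subset \bigcup_(W in powerset T :\: freq (F L)) E W.
    apply/subsetP => x /setIdP[Hx xV]; apply/bigcupP; exists (commset x C).
      rewrite inE stable andbC inE; apply/andP; split.
        by apply/subsetP => _ /imsetP[a Ca ->]; exact: CT.
      apply: contra xV => fx; apply/subsetP => v /VP[_ /(_ _ fx)].
      case/imsetP=> a Ca ->; apply: imset_f.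
      exact: (subsetP (normal_sub nsCG)).
    by rewrite inE Hx eqxx.
  apply: (@leq_trans (\sum_(W in powerset T :\: freq (F L)) F L * #|E W|)%N).
    rewrite -big_distrr leq_mul2l; apply/orP; right.
    exact: leq_trans (subset_leq_card sub) (leq_card_bigcup _ _).
  apply: (@leq_trans (\sum_(W in powerset T :\: freq (F L)) #|H|)%N).
    apply: leq_sum => W; rewrite !inE => /andP[+ TW].
    by rewrite TW -ltnNge => /ltnW.
  rewrite sum_nat_const leq_mul2r; apply/orP; right.
  apply: leq_trans (subset_leq_card (subsetDl _ _)) _.
  by rewrite card_powerset leq_pexp2l.
Qed.

(** * Pairs whose commutator lies in [V] *)

Definition commg_pairs (gT : finGroupType) (G V : {set gT}) : {set gT * gT} :=
  [set u in setX G G | [~ u.1, u.2] \in V].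

(** Once [[~ x, g] = v] has a solution [g], all solutions form the coset ['C_G[x] :* g]. *)
Lemma card_commg_fiber (gT : finGroupType) (G : {group gT}) (x v : gT) :
  x \in G -> #|[set y in G | [~ x, y] == v]| = ((v \in commset x G) * #|'C_G[x]|)%N.
Proof.
move=> Gx; have [/imsetP[g Gg vE]|nv] := boolP (v \in commset x G); last first.
  rewrite mul0n; apply/eqP; rewrite cards_eq0; apply/eqP/setP => y; rewrite !inE.
  by apply: contraNF nv => /andP[Gy /eqP <-]; apply: imset_f.
rewrite mul1n -(card_rcoset 'C_G[x] g); apply: eq_card => y.
rewrite mem_rcoset inE in_setI groupMr ?groupV //; congr andb.
rewrite vE !commgEl (inj_eq (mulgI _)); apply/eqP/cent1P => [xy|].
  by apply/commute_sym/commgP/conjg_fixP; rewrite conjgM xy conjgK.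
by move=> /commute_sym/commgP/conjg_fixP; rewrite conjgM => /(canRL (conjgKV _)).
Qed.

Lemma card_commg_pairs (gT : finGroupType) (G : {group gT}) (V : {set gT}) :
  #|commg_pairs G V| = (\sum_(x in G) #|V :&: commset x G| * #|'C_G[x]|)%N.
Proof.
rewrite -sum1_card (eq_bigl (fun u => (u.1 \in G) && ((u.2 \in G) && ([~ u.1, u.2] \in V)))).
  rewrite -(pair_big_dep (mem G) (fun x y => (y \in G) && ([~ x, y] \in V)) (fun _ _ => 1%N)) /=.
  apply: eq_bigr => x Gx.
  rewrite (partition_big (fun y => [~ x, y]) (mem V)) /=; last by move=> y /andP[].
  rewrite -sum1_card big_distrl /= [RHS]big_mkcond [LHS]big_mkcond /=.
  apply: eq_bigr => v _; rewrite inE; case: (boolP (v \in V)) => //= Vv.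
  transitivity #|[set y in G | [~ x, y] == v]|.
    rewrite -sum1_card; apply: eq_bigl => y; rewrite inE -andbA; congr andb.
    by apply: andb_idl => /eqP ->.
  by rewrite card_commg_fiber //; case: (v \in _).
by move=> u; rewrite !inE andbA.
Qed.

Lemma card_commuting_pairs (gT : finGroupType) (G : {group gT}) :
  #|[set u in setX G G | u.1 * u.2 == u.2 * u.1]| = (\sum_(x in G) #|'C_G[x]|)%N.
Proof.
transitivity #|commg_pairs G 1|.
  apply: eq_card => u; rewrite !inE; congr andb.
  by apply/eqP/eqP => [/commgP/eqP|/eqP/commgP].
rewrite card_commg_pairs; apply: eq_bigr => x Gx.
rewrite (setIidPl _) ?cards1 ?mul1n // sub1set.
by apply/imsetP; exists 1; rewrite ?commg1.
Qed.

(** Each [x] contributes [#|V :&: commset x G| * #|'C_G[x]|] pairs, and the first factor is [#|V|]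
    as soon as [V] lies in [commset x G]. *)
Lemma commg_pairs_bounds (gT : finGroupType) (G V : {group gT}) :
  (#|commg_pairs G V| <= #|V| * \sum_(x in G) #|'C_G[x]| <=
   #|commg_pairs G V| + #|V| * \sum_(x in G | ~~ (V \subset commset x G)) #|'C_G[x]|)%N.
Proof.
rewrite card_commg_pairs !big_distrr /=; apply/andP; split.
  by apply: leq_sum => x _; rewrite leq_mul2r subset_leq_card ?orbT ?subsetIl.
rewrite [X in (_ <= _ + X)%N]big_mkcondr -big_split /=.
apply: leq_sum => x _; case: ifPn; first by rewrite leq_addl.
by rewrite negbK addn0 => /setIidPl ->.
Qed.

(** Both products equal [s * t * (a * b)] times a commutator in [A], so commutation becomes an
    equation between homomorphisms in [a] and in [b]. *)
Lemma commute_translates (gT : finGroupType) (A : {group gT}) (s t a b : gT) :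
  abelian A -> s \in 'N(A) -> t \in 'N(A) -> commute s t -> a \in A -> b \in A ->
  ([~ s * a, t * b] == 1) = ([~ a, t] == [~ b, s]).
Proof.
move=> /centsP abA nAs nAt cst Aa Ab.
have Aat : [~ a, t] \in A by rewrite commgEl groupM ?groupV ?memJ_norm.
have Abs : [~ b, s] \in A by rewrite commgEl groupM ?groupV ?memJ_norm.
have E1 : s * a * (t * b) = s * t * (a * b) * [~ a, t].
  by rewrite -!mulgA (abA _ Ab _ Aat) commgEl conjgE !mulgA !mulgK.
have E2 : t * b * (s * a) = s * t * (a * b) * [~ b, s].
  rewrite (abA _ Aa _ Ab) -!mulgA (abA _ Aa _ Abs) commgEl conjgE !mulgA mulgK.
  by rewrite cst mulgK.
apply/idP/idP => [/commgP|/eqP E3]; last by apply/commgP; rewrite /commute E1 E2 E3.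
by rewrite /commute E1 E2 => /mulgI/eqP.
Qed.

(** Translated by the solution [r], the solutions form the equaliser [Q] of two homomorphisms from
    [B x B] to the abelian group [B / V]; Lagrange's theorem gives the divisibility. *)
Lemma card_commg_pairs_coset (gT : finGroupType) (G V B : {group gT}) (r : gT * gT) :
  G \subset 'N(V) -> B <| G -> [~: B, B] \subset V -> r \in commg_pairs G V ->
  (#|commg_pairs G V :&: r *: setX B B| %| #|setX B B|)%N.
Proof.
case: r => s t nVG /andP[sBG nBG] derB /setIdP[/setXP[Gs Gt] /= stV].
have nVB := subset_trans sBG nVG.
have abA : abelian (B / V) by rewrite /abelian quotient_cents2r.
have nA g : g \in G -> coset V g \in 'N(B / V).
  by move=> Gg; apply: (subsetP (quotient_norms V nBG)); rewrite mem_quotient.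
have cst : commute (coset V s) (coset V t).
  by apply/commgP; rewrite -morphR ?(subsetP nVG) //; apply/eqP/coset_id.
have memE a b : a \in B -> b \in B ->
  ([~ s * a, t * b] \in V) = ([~ coset V a, coset V t] == [~ coset V b, coset V s]).
  move=> Ba Bb; have [Ga Gb] := (subsetP sBG a Ba, subsetP sBG b Bb).
  have nV g : g \in G -> g \in 'N(V) by exact: (subsetP nVG).
  have nsa : s * a \in 'N(V) by rewrite nV ?groupM.
  have ntb : t * b \in 'N(V) by rewrite nV ?groupM.
  rewrite -(commute_translates abA) ?nA ?mem_quotient // -!morphM ?nV // -morphR //.
  apply/idP/eqP => [|E]; first exact: coset_id.
  by apply: coset_idr E; rewrite groupR.
pose Q := [set u in setX B B | [~ s * u.1, t * u.2] \in V].
have gQ : group_set Q.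
  apply/group_setP; split; first by rewrite !inE !group1 !mulg1.
  move=> [a b] [a' b'] /setIdP[/setXP /= [Ba Bb] abV] /setIdP[/setXP /= [Ba' Bb'] abV'].
  apply/setIdP; split; first by apply/setXP; rewrite /= !groupM.
  rewrite memE ?groupM // !morphM ?(subsetP nVB) // !commMgJ.
  move: abV abV'; rewrite !memE //= => /eqP abE /eqP ->; apply/eqP; congr (_ * _).
  have fixB c : c \in B -> [~ coset V b, coset V s] ^ coset V c = [~ coset V b, coset V s].
    move=> Bc; rewrite conjgE (centsP abA _ _ _ (mem_quotient V Bc)) ?mulKg //.
    by rewrite commgEl groupM ?groupV ?memJ_norm ?nA ?mem_quotient.
  by rewrite /= abE !fixB.
have -> : commg_pairs G V :&: (s, t) *: setX B B = (s, t) *: Q.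
  apply/setP => -[x y]; rewrite inE !mem_lcoset [in RHS]inE /= !mulKVg.
  apply/andP/andP => [[/setIdP[_ xyV] //]|[sxty xyV]]; split=> //.
  have /setXP[/= Bx By] := sxty; apply/setIdP; split=> //; apply/setXP.
  rewrite -(groupMl x (groupVr Gs)) -(groupMl y (groupVr Gt)).
  by rewrite (subsetP sBG _ Bx) (subsetP sBG _ By).
have sQ : Group gQ \subset setX_group B B by apply/subsetP => u /setIdP[].
by rewrite card_lcoset; exact (cardSg sQ).
Qed.

(** * Egyptian complexity of the approximating value *)

Local Open Scope ring_scope.

(** Dropping the zero terms leaves a sum of unit fractions, whose length bounds the least possible
    one; a zero total has complexity 0. *)
Lemma egyptian_complexity_sum (R : realType) (T : finType) (P : {set T}) (u : T -> R) :
  (forall i, i \in P -> u i = 0 \/ exists2 n, (0 < n)%N & u i = n%:R^-1) ->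
  exists2 m, egyptian_complexity (\sum_(i in P) u i) = Some m & (m <= #|P|)%N.
Proof.
move=> uP; have [->|q_neq0] := eqVneq (\sum_(i in P) u i) 0.
  by exists 0%N => //; rewrite egyptian_complexity0.
pose S := [set i in P | u i != 0].
have uS i : i \in S -> exists2 n, (0 < n)%N & u i = n%:R^-1.
  by case/setIdP => /uP[-> /eqP //|].
have sumS : \sum_(i in P) u i = \sum_(j < #|S|) u (enum_val j).
  rewrite -(big_enum_val (fun i => u i)) [LHS](bigID (fun i => u i == 0)) /=.
  rewrite [X in X + _]big1 ?add0r => [|i /andP[_ /eqP] //].
  by apply: eq_bigl => i; rewrite inE.
have S_gt0 : (0 < #|S|)%N.
  rewrite lt0n; apply: contraNneq q_neq0 => S0; rewrite sumS big1 // => j.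
  by exfalso; have := ltn_ord j; rewrite [X in (_ < X)%N]S0.
have /choice[n nE] : forall j : 'I_#|S|, exists n : nat, (0 < n)%N /\ u (enum_val j) = n%:R^-1.
  by move=> j; have [n n_gt0 uE] := uS _ (enum_valP j); exists n.
have suf : sum_of_unit_fractions (\sum_(i in P) u i) #|S|.
  exists n; split=> [j|]; first by case: (nE j).
  by rewrite sumS; apply: eq_bigr => j _; case: (nE j).
rewrite /egyptian_complexity (negPf q_neq0); case: pselect => [ex_m|[]]; last first.
  by exists #|S|; rewrite S_gt0; apply/asboolP.
case: ex_minnP => m _ m_min; exists m => //.
apply: leq_trans (m_min #|S| _) _; first by rewrite S_gt0; apply/asboolP.
by apply/subset_leq_card/subsetP => i /setIdP[].
Qed.

Lemma egyptian_complexity_commg_pairs (R : realType) (gT : finGroupType) (G V B : {group gT}) :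
  G \subset 'N(V) -> B <| G -> [~: B, B]%g \subset V ->
  exists2 m, egyptian_complexity (#|commg_pairs G V|%:R / (#|V|%:R * #|G|%:R ^+ 2) : R) = Some m
    & (m <= #|G : B| ^ 2)%N.
Proof.
move=> nVG nsBG derB; have [sBG nBG] := andP nsBG.
pose G2 := setX_group G G; pose B2 := setX_group B B.
have sB2G2 : B2 \subset G2 by apply: setXS.
have indexB2 : (#|G2 : B2| = #|G : B| ^ 2)%N.
  rewrite -divgS //= !cardsX -(Lagrange sBG) mulnACA mulKn //.
  by rewrite muln_gt0 !cardG_gt0.
pose P := commg_pairs G V.
have sPG2 : P \subset G2 by apply/subsetP => u /setIdP[].
pose D : R := #|V|%:R * #|G|%:R ^+ 2.
have -> : #|P|%:R / D = \sum_(K in rcosets B2 G2) #|P :&: K|%:R / D.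
  by rewrite (card_rcosets_sum sB2G2 sPG2) natr_sum mulr_suml.
have [|m mE le] := @egyptian_complexity_sum R _ (rcosets B2 G2) (fun K => #|P :&: K|%:R / D).
  move=> _ /rcosetsP[u Gu ->].
  have [->|[r /setIP[Pr Kr]]] := set_0Vmem (P :&: (B2 :* u)%g).
    by left; rewrite cards0 mul0r.
  right.
  have nr : r \in ('N(B2))%g.
    have /setXP[Gr1 Gr2] : (r.1, r.2) \in setX G G by rewrite -surjective_pairing (subsetP sPG2).
    rewrite inE; apply/subsetP => _ /imsetP[[b b'] /setXP[Bb Bb'] ->].
    by apply/setXP; split; rewrite /= memJ_norm // (subsetP nBG).
  rewrite -(rcoset_eqP Kr) (norm_rlcoset nr).
  have /dvdnP[c cE] := card_commg_pairs_coset nVG nsBG derB Pr.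
  (* Since [#|B2| = c * k], this [n] gives [n * k = #|V| * #|G| ^ 2], so [k / D] is exactly
     [n^-1]. *)
  set k := #|P :&: (r *: B2)%g|; pose n := (c * #|V| * #|G2 : B2|)%N.
  have nkE : (n * k = #|V| * #|G| ^ 2)%N.
    have cE' : #|B2| = (c * k)%N := cE.
    have GE : (#|G| ^ 2 = #|B2| * #|G2 : B2|)%N.
      by rewrite (Lagrange sB2G2) cardsX.
    by rewrite GE cE' /n; lia.
  have : (0 < n * k)%N by rewrite nkE muln_gt0 expn_gt0 !cardG_gt0.
  rewrite muln_gt0 => /andP[n_gt0 k_gt0]; exists n => //.
  rewrite /D -natrX -natrM -nkE natrM invfM mulrCA divff ?mulr1 //.
  by rewrite pnatr_eq0 -lt0n.
by exists m; rewrite // -indexB2.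
Qed.

(** * Choice of the constants and conclusion *)

Lemma leq_card_cent1_large (gT : finGroupType) (G : {group gT}) (P : pred gT) (n : nat) :
  (forall x, x \in G -> P x -> (n <= #|x ^: G|)%N) ->
  (n * \sum_(x in G | P x) #|'C_G[x]%g| <= #|G| ^ 2)%N.
Proof.
move=> Pn; rewrite big_distrr /= -mulnn -{1}sum1_card big_distrl /= big_mkcondr /=.
apply: leq_sum => x Gx; rewrite mul1n; case: ifP => // Px.
by rewrite -(card_cent1_class G x) mulnC leq_mul2l Pn ?orbT.
Qed.

(** Supplies the growth functions of both pigeonholes: [lb] forces growth, [a] makes the error
    small. A [sig] type lets [sval] name the function. *)
Lemma natr_dominating (R : realType) (lb : nat -> nat) (a : nat -> R) :
  {F : nat -> nat | forall n, (lb n <= F n)%N /\ a n <= (F n)%:R}.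
Proof.
exists (fun n => maxn (lb n) (Num.bound `|a n|)) => n; split; first exact: leq_maxl.
apply: le_trans (ler_norm _) (le_trans (ltW (archi_boundP (normr_ge0 _))) _).
by rewrite ler_nat leq_maxr.
Qed.

(** The constants are chosen backwards: [F2] depends on the class bound [N] from the first
    pigeonhole, while [F1] must anticipate every outcome of the second. *)
Lemma approximation (R : realType) (eta : nat -> R) (N0 : nat) :
  (forall n, 0 < eta n) -> (forall m n, (m <= n)%N -> eta n <= eta m) -> (0 < N0)%N ->
  exists M : nat, forall (gT : finGroupType) (G : {group gT}),
    (#|G| <= N0 * #|small_class G N0|)%N ->
    exists b (V B : {group gT}), [/\ (b <= M)%N, (#|G : B| ^ 2 <= b)%N,
      [/\ G \subset 'N(V), B <| G & [~: B, B]%g \subset V] &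
      (\sum_(x in G | ~~ (V \subset commset x G)) #|'C_G[x]%g|)%:R
        <= eta b * #|G|%:R ^+ 2].
Proof.
move=> eta_gt0 eta_decr N0_gt0.
pose J N := (2 ^ (N ^ (N + 3)))%N.
(* The square of the bound on [#|G : B|] provided by the second pigeonhole. *)
pose b N L := ((N0 * N ^ (N ^ (N + 3)) * L ^ J N) ^ 2)%N.
have half_gt0 n : 0 < eta n / 2 by rewrite divr_gt0.
pose F2 N := sval (natr_dominating id (fun L => (J N)%:R / (eta (b N L) / 2))).
have F2P N L : (L <= F2 N L)%N /\ (J N)%:R <= (F2 N L)%:R * (eta (b N L) / 2).
  by rewrite /F2; case: natr_dominating => F /= /(_ L)[lF aF]; split=> //; rewrite -ler_pdivrMr.
(* Covers all levels the second pigeonhole may return; [eta] being decreasing, [eta (bmax N)] works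
   for each of them. *)
pose bmax N := (\max_(j < (J N).+1) b N (iter j (F2 N) 1))%N.
(* The summand [N * N] will make stage [N] closed under products. *)
pose F1 := sval (natr_dominating (fun N => N + N * N)%N (fun N => 1 / (eta (bmax N) / 2))).
have F1P N : (N + N * N <= F1 N)%N /\ 1 <= (F1 N)%:R * (eta (bmax N) / 2).
  by rewrite /F1; case: natr_dominating => F /= /(_ N)[lF aF]; split=> //; rewrite -ler_pdivrMr.
pose lev k := (iter k (fun n => F1 (n * N0) * N0) N0 * N0)%N.
exists (\max_(k < N0.+1) bmax (lev k))%N => gT G G_le.
have leF1 n : (n <= F1 n)%N by case: (F1P n) => /(leq_trans (leq_addr _ _)).
have [k lek stable] := small_class_stable N0_gt0 leF1 G_le.
set N := lev k; rewrite -/(lev k) /= -/N in stable.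
have N0_le : (N0 <= N)%N.
  apply: leq_pmull; elim: (k) => //= i IHi.
  by rewrite muln_gt0 N0_gt0 andbT (leq_trans _ (leF1 _)) ?muln_gt0 ?IHi.
have [H nsHG HE] : exists2 H : {group gT}, H <| G & H = small_class G N :> {set gT}.
  apply: small_class_group; first exact: leq_trans N0_le.
  apply: subset_trans stable; apply: small_class_le.
  by case: (F1P N) => /(leq_trans (leq_addl _ _)).
have sHG := normal_sub nsHG.
have indexH : (#|G : H| <= N0)%N.
  rewrite -(leq_pmul2l (cardG_gt0 H)) Lagrange //.
  apply: leq_trans G_le _; rewrite mulnC leq_mul2r; apply/orP; right.
  by rewrite HE; apply/subset_leq_card/small_class_le.
have HN x : x \in H -> (#|x ^: H| <= N)%N.
  move=> Hx; have: x \in small_class G N by rewrite -HE.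
  by case/setIdP=> _; apply: leq_trans; apply/subset_leq_card/imsetS.
have [j lej [V [B [nVG nsBG derB indexB bad_le]]]] :=
  generic_commset (fun L => (F2P N L).1) nsHG indexH HN.
set L := iter j (F2 N) 1%N in indexB bad_le.
exists (b N L), V, B; split=> //.
- apply: leq_trans (leq_bigmax (Ordinal (lek : (k < N0.+1)%N))).
  exact: leq_trans (leq_bigmax (Ordinal (lej : (j < (J N).+1)%N))).
- by rewrite /b leq_exp2r.
set bad := [set x in H | _] in bad_le.
have le_eta : eta (bmax N) <= eta (b N L).
  exact/eta_decr/(leq_bigmax (Ordinal (lej : (j < (J N).+1)%N))).
pose A := (\sum_(x in G | x \notin H) #|'C_G[x]%g|)%N.
have A_le : (F1 N * A <= #|G| ^ 2)%N.
  apply: leq_card_cent1_large => x Gx; rewrite HE leqNgt; apply: contra => /ltnW small.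
  by apply: (subsetP stable); rewrite inE Gx.
(* Outside [H] centralisers are small since classes are large; inside [H] they are bounded only by
   [#|G|], but bad elements are few. Each part receives half of [eta]. *)
have sum_le : (\sum_(x in G | ~~ (V \subset commset x G)) #|'C_G[x]%g| <= A + #|bad| * #|G|)%N.
  rewrite (bigID (mem H)) /= addnC; apply: leq_add.
    rewrite [X in (_ <= X)%N]big_mkcond [X in (X <= _)%N]big_mkcond /=.
    apply: leq_sum => x _; rewrite -andbA.
    by case: (x \in G); case: (x \notin H); rewrite ?andbF ?andbT //=; case: ifP.
  rewrite -sum_nat_const [X in (_ <= X)%N]big_mkcond [X in (X <= _)%N]big_mkcond /=.
  apply: leq_sum => x _; rewrite inE; case: (x \in H); rewrite ?andbF ?andbT //=.
  case: (x \in G) => //=; case: ifP => // _.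
  by apply/subset_leq_card/subsetIl.
have {}A_le : A%:R <= eta (b N L) / 2 * #|G|%:R ^+ 2.
  have [_ F1_ge] := F1P N.
  have : (F1 N)%:R * A%:R <= #|G|%:R ^+ 2 :> R by rewrite -natrM -natrX ler_nat.
  have A_ge0 : 0 <= A%:R :> R by [].
  have F1_ge0 : 0 <= (F1 N)%:R :> R by [].
  have := half_gt0 (b N L); have := half_gt0 (bmax N).
  move: le_eta F1_ge A_ge0 F1_ge0.
  move: (eta _) (eta _) A%:R (F1 N)%:R (#|G|%:R ^+ 2) => e' e a f g.
  move=> ee' fe a0 f0 e0 e'0 fa.
  have fe' : 1 <= f * (e' / 2) by apply: le_trans fe _; rewrite ler_wpM2l //; lra.
  have := ler_wpM2l a0 fe'; have := ler_wpM2r (ltW e'0) fa; lra.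
have {}bad_le : #|bad|%:R <= eta (b N L) / 2 * #|G|%:R.
  have [_ F2_ge] := F2P N L.
  have J_gt0 : 0 < (J N)%:R :> R by rewrite ltr0n expn_gt0.
  have F2_gt0 : 0 < (F2 N L)%:R :> R.
    by rewrite lt0r ler0n andbT; apply: contraTneq F2_ge => ->; rewrite mul0r -ltNge.
  rewrite -(ler_pM2l F2_gt0) mulrA; apply: le_trans (ler_wpM2r (ler0n _ _) F2_ge).
  by rewrite -!natrM ler_nat (leq_trans bad_le) // leq_mul2l subset_leq_card ?orbT.
apply: (@le_trans _ _ (A + #|bad| * #|G|)%:R); first by rewrite ler_nat.
rewrite natrD natrM.
have : #|bad|%:R * #|G|%:R <= eta (b N L) / 2 * #|G|%:R * #|G|%:R :> R by rewrite ler_wpM2r.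
move: A_le; rewrite expr2; lra.
Qed.

(** Elements outside [small_class G N0] give at most [#|G| ^ 2 / N0] commuting pairs, at most half
    of [c * #|G| ^ 2]. The others give more than [#|G| ^ 2 / N0], at most [#|G|] each. *)
Lemma card_small_class_large (R : realType) (c : R) (N0 : nat) (gT : finGroupType)
    (G : {group gT}) :
  2 <= N0%:R * c -> c < commuting_prob R G -> (#|G| <= N0 * #|small_class G N0|)%N.
Proof.
rewrite /commuting_prob card_commuting_pairs => N0c.
have G_gt0 : 0 < #|G|%:R :> R by rewrite ltr0n cardG_gt0.
rewrite ltr_pdivlMr ?exprn_gt0 // => lt_sum.
have large : (N0 * \sum_(x in G | x \notin small_class G N0) #|'C_G[x]%g| <= #|G| ^ 2)%N.
  apply: leq_card_cent1_large => x Gx; rewrite inE Gx -ltnNge; exact: ltnW.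
have small : (\sum_(x in G | x \in small_class G N0) #|'C_G[x]%g| <= #|small_class G N0| * #|G|)%N.
  rewrite -sum_nat_const [X in (_ <= X)%N]big_mkcond [X in (X <= _)%N]big_mkcond /=.
  apply: leq_sum => x _; case: (x \in G) => //=; case: ifP => // _.
  by apply: subset_leq_card; apply: subsetIl.
move: lt_sum large small; rewrite (bigID (mem (small_class G N0))) /=.
move: (\sum_(x in G | x \notin _) _)%N (\sum_(x in G | _) _)%N => a b lt_sum.
rewrite -!(ler_nat R) !natrM => large small; rewrite -(ler_pM2r G_gt0).
have := ler_wpM2r (ltW (exprn_gt0 2 G_gt0)) N0c.
have := ler_wpM2l (ler0n R N0) (ltW lt_sum); have := ler_wpM2l (ler0n R N0) small.
move: large; rewrite natrD expr2; lra.
Qed.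

Theorem theorem1p2 (R : realType) (eta : nat -> R)
    (eta_range : forall n : nat, 0 < eta n < 1)
    (eta_decr : forall m n : nat, (m <= n)%N -> eta n <= eta m) :
  exists M : nat, forall (gT : finGroupType) (G : {group gT}),
    exists q eps : R,
      [/\ commuting_prob R G = q + eps, 0 <= q &
          exists m : nat,
            [/\ egyptian_complexity q = Some m, (m <= M)%N
              & 0 <= eps <= eta m]].
Proof.
have eta_gt0 n : 0 < eta n by case/andP: (eta_range n).
pose N0 := (Num.bound (2 / eta 0%N)).+1.
have N0_ge : 2 <= N0%:R * eta 0%N.
  rewrite -ler_pdivrMr // ltW // (lt_le_trans (archi_boundP _)) ?ler_nat //.
  by rewrite divr_ge0 // ltW.
have [M approx] := approximation eta_gt0 eta_decr (ltn0Sn _ : (0 < N0)%N).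
exists M => gT G; have G_gt0 : 0 < #|G|%:R :> R by rewrite ltr0n cardG_gt0.
have [small|large] := leP (commuting_prob R G) (eta 0%N).
  (* With [q = 0], of complexity 0, the whole probability is the error. *)
  exists 0, (commuting_prob R G); split; rewrite ?add0r //.
  exists 0%N; rewrite egyptian_complexity0 small andbT; split=> //.
  by rewrite /commuting_prob divr_ge0 ?exprn_ge0.
have [b [V [B [leM leb [nVG nsBG derB] bad_le]]]] :=
  approx _ _ (card_small_class_large N0_ge large).
have [m mE le_m] := egyptian_complexity_commg_pairs R nVG nsBG derB.
set q := _ / _ in mE.
have V_gt0 : 0 < #|V|%:R :> R by rewrite ltr0n cardG_gt0.
exists q, (commuting_prob R G - q); split; first by rewrite subrKC.
  by rewrite /q divr_ge0 ?mulr_ge0.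
have le_mb : (m <= b)%N := leq_trans le_m leb.
exists m; split=> //; first exact: leq_trans leM.
have D_gt0 : 0 < #|V|%:R * #|G|%:R ^+ 2 :> R by rewrite mulr_gt0 ?exprn_gt0.
have -> : commuting_prob R G - q =
    ((#|V| * \sum_(x in G) #|'C_G[x]%g|)%:R - #|commg_pairs G V|%:R) / (#|V|%:R * #|G|%:R ^+ 2).
  rewrite /commuting_prob card_commuting_pairs /q natrM mulrBl; congr (_ - _).
  by rewrite -mulf_div divff ?mul1r // gt_eqF.
have /andP[lo hi] := commg_pairs_bounds G V.
rewrite divr_ge0 ?subr_ge0 ?ler_nat // ?(ltW D_gt0) //= ler_pdivrMr //.
(* The error is controlled by [eta b]; as [m <= b] and [eta] decreases, also by [eta m]. *)
apply: le_trans (_ : eta b * (#|V|%:R * #|G|%:R ^+ 2) <= _); last first.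
  by rewrite ler_wpM2r ?(ltW D_gt0) ?eta_decr.
rewrite lerBlDl mulrCA; move: hi; rewrite -(ler_nat R) natrD [X in _ <= _ + X -> _]natrM.
by move/le_trans; apply; rewrite lerD2l ler_wpM2l.
Qed.
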